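(* In a PRAM computer with a large enough number of processors ($P\to\infty$), and for the linear quadratic tracking (LQT) problem with state dimension $n_x$, control dimension $n_u$ and $T$ time steps, the span time complexity of the parallel algorithms described in the context is as follows: (i) computing the value functions and the control law takes $O(n_u+n_x\log T)$; (ii) recovering the optimal trajectory takes $O(\log n_u+(\log T)(\log n_x))$ with Method 1, and $O(n_x+n_x\log T)$ with Method 2.
   Context: LQT problem: dynamics $x_{k+1}=F_kx_k+c_k+L_ku_k$ ($x_k\in\mathbb R^{n_x}$, $u_k\in\mathbb R^{n_u}$, $n_u\le n_x$), stage costs $\ell_n(x_n,u_n)=\frac12(H_nx_n-r_n)^\top X_n(H_nx_n-r_n)+\frac12u_n^\top U_nu_n$ for $n=S,\dots,T-1$, terminal cost $\ell_T(x_T)=\frac12(H_Tx_T-r_T)^\top X_T(H_Tx_T-r_T)$, with $X_n$ symmetric positive semidefinite and $U_n$ symmetric positive definite. The value functions are $V_k(x_k)=\mathrm z+\frac12x_k^\top S_kx_k-v_k^\top x_k$ ($\mathrm z$ an undetermined constant), and the optimal control law is $u_k=-K_kx_k+K_k^vv_{k+1}-K_k^cc_k$ with $K_k=M_k^{-1}L_k^\top S_{k+1}F_k$, $K_k^v=M_k^{-1}L_k^\top$, $K_k^c=M_k^{-1}L_k^\top S_{k+1}$, $M_k=L_k^\top S_{k+1}L_k+U_k$. Machine model: a PRAM (parallel random access machine) has identical processors with a common clock and shared random access memory; the number of processors is taken large enough not to limit the parallelisation. Span time is the number of parallel steps. Parallel matrix routines are used: a product of $n\times n$ matrices takes $O(\log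 n)$ span and an LU factorisation (used for solving linear systems or inverting) of an $n\times n$ matrix takes $O(n)$ span. The parallel scan algorithm (up-sweep and down-sweep over a binary tree) computes all prefix (or suffix) products of $T$ elements under an associative operator using $O(\log T)$ successive rounds, the operator applications in each round being done in parallel. Logarithms inside $O(\cdot)$ are understood as $\max(1,\log)$. Algorithms: - Elements and operator for value functions: tuples $(A,b,C,\eta,J)$ of $n_x\times n_x$ matrices $A,C,J$ and $n_x$-vectors $b,\eta$, combined as $(A_{k,j},b_{k,j},C_{k,j},\eta_{k,j},J_{k,j})\otimes(A_{j,i},b_{j,i},C_{j,i},\eta_{j,i},J_{j,i})=(A_{k,i},b_{k,i},C_{k,i},\eta_{k,i},J_{k,i})$ with $A_{k,i}=A_{j,i}(I+C_{k,j}J_{j,i})^{-1}A_{k,j}$, $b_{k,i}=A_{j,i}(I+C_{k,j}J_{j,i})^{-1}(b_{k,j}+C_{k,j}\eta_{j,i})+b_{j,i}$, $C_{k,i}=A_{j,i}(I+C_{k,j}J_{j,i})^{-1}C_{k,j}A_{j,i}^\top+C_{j,i}$, $\eta_{k,i}=A_{k,j}^\top(I+J_{j,i}C_{k,j})^{-1}(\eta_{j,i}-J_{j,i}b_{k,j})+\eta_{k,j}$, $J_{k,i}=A_{k,j}^\top(I+J_{j,i}C_{k,j})^{-1}J_{j,i}A_{k,j}+J_{k,j}$. - Value functions and control law: initialise in parallel $a_k=(F_k,c_k,L_kU_k^{-1}L_k^\top,H_k^\top X_kr_k,H_k^\top X_kH_k)$ for $k<T$ and $a_T=(0,0,0,H_T^\top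 X_Tr_T,H_T^\top X_TH_T)$; run a backward parallel scan with the operator $\otimes$ on tuples $(A,b,C,\eta,J)$; the $J$ and $\eta$ components of $a_k\otimes\cdots\otimes a_T$ are $S_k$ and $v_k$; then compute the control gains for all $k$ in parallel. - Trajectory recovery, Method 1 (given the value functions and control law): with $\widetilde F_k=F_k-L_kK_k$ and $\widetilde c_k=c_k+L_kK_k^vv_{k+1}-L_kK_k^cc_k$, initialise pairs $a_S=(0,\widetilde F_Sx_S+\widetilde c_S)$ and $a_k=(\widetilde F_k,\widetilde c_k)$ for $k=S+1,\dots,T-1$; run a forward parallel scan with $(F,c)\otimes(F',c')=(F'F,F'c+c')$; the second component of $a_S\otimes\cdots\otimes a_{k-1}$ is the optimal state $x_k^*$. - Trajectory recovery, Method 2: run a forward parallel scan with the value-function elements $a_k=(F_k,c_k,L_kU_k^{-1}L_k^\top,H_k^\top X_kr_k,H_k^\top X_kH_k)$, $k=S,\dots,T-1$, and the operator $\otimes$ on tuples $(A,b,C,\eta,J)$ to obtain the parameters $(A_{S,k},b_{S,k},C_{S,k},\eta_{S,k},J_{S,k})=a_S\otimes\cdots\otimes a_{k-1}$ for all $k$ and, with $S_k,v_k$ available, compute in parallel $x_k^*=(I+C_{S,k}S_k)^{-1}(A_{S,k}x_S+b_{S,k}+C_{S,k}v_k)$. *)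

(* Defs.v *)
From mathcomp Require Import all_boot all_order all_algebra.
From mathcomp Require Import reals exp.

Set Implicit Arguments.
Unset Strict Implicit.
Unset Printing Implicit Defensive.

Import Order.TTheory GRing.Theory Num.Theory.
Local Open Scope ring_scope.

Definition log1 (R : realType) (n : nat) : R := Num.max 1 (ln n%:R).

(* [prog V A] is the type of structured PRAM programs returning an [A].
   [V m n] is the type of m x n matrices held in the shared memory. Every
   algorithm below is polymorphic in [V]: the only way for it to obtain a new
   matrix is therefore to issue one of the instructions [Zero] to [Inv], each
   of which is charged by [span_time]. [Ret] only moves references around.
   [Par n f] starts the n programs [f i] on the same clock tick, on disjoint
   groups of processors (their number is not limited), and synchronises when
   the last one stops. *)
Inductive prog (V : nat -> nat -> Type) : Type -> Type :=
| Ret A : A -> prog V A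
| Seq A B : prog V A -> (A -> prog V B) -> prog V B
| Par n A : ('I_n -> prog V A) -> prog V ('I_n -> A)
| Zero m n : prog V (V m n)
| Id n : prog V (V n n)
| Tr m n : V m n -> prog V (V n m)
| Add m n : V m n -> V m n -> prog V (V m n)
| Sub m n : V m n -> V m n -> prog V (V m n)
| Mul m n p : V m n -> V n p -> prog V (V m p)
| Inv n : V n n -> prog V (V n n).

Arguments Ret {V A}.
Arguments Seq {V A B}.
Arguments Par {V n A}.
Arguments Zero {V m n}.
Arguments Id {V n}.

Fixpoint result (R : realType) A (p : prog (matrix R) A) : A :=
  match p with
  | Ret _ a => a
  | Seq _ _ q f => result (f (result q))
  | Par _ _ f => fun i => result (f i)
  | Zero _ _ => 0
  | Id _ => 1%:M
  | Tr _ _ a => a^T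
  | Add _ _ a b => a + b
  | Sub _ _ a b => a - b
  | Mul _ _ _ a b => a *m b
  | Inv _ a => invmx a
  end.

(* Numbers of parallel steps of the two matrix routines: the product of an
   m x n by an n x p matrix, and the inversion of an n x n matrix through an
   LU factorisation. *)
Record routines := Routines {
  mul_steps : nat -> nat -> nat -> nat;
  inv_steps : nat -> nat }.

(* Number of parallel steps. Entrywise instructions take one step, one
   processor handling one entry. *)
Fixpoint span_time (R : realType) (M : routines) A (p : prog (matrix R) A) : nat :=
  match p with
  | Ret _ _ => 0
  | Seq _ _ q f => span_time M q + span_time M (f (result q))
  | Par n _ f => \max_(i < n) span_time M (f i)
  | Zero _ _ | Id _ | Tr _ _ _ | Add _ _ _ _ | Sub _ _ _ _ => 1
  | Mul m n p _ _ => mul_steps M m n p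
  | Inv n _ => inv_steps M n
  end%N.

Declare Scope prog_scope.
Delimit Scope prog_scope with prog.
Bind Scope prog_scope with prog.

Definition seq_tr V m n (p : prog V (V m n)) := Seq p (@Tr V m n).
Definition seq_inv V n (p : prog V (V n n)) := Seq p (@Inv V n).
Definition seq_add V m n (p q : prog V (V m n)) :=
  Seq p (fun a => Seq q (fun b => Add a b)).
Definition seq_sub V m n (p q : prog V (V m n)) :=
  Seq p (fun a => Seq q (fun b => Sub a b)).
Definition seq_mul V m n k (p : prog V (V m n)) (q : prog V (V n k)) :=
  Seq p (fun a => Seq q (fun b => Mul a b)).

Notation "x <- p ;; q" := (Seq p (fun x => q))
  (at level 100, p at next level, q at level 200, right associativity,
   format "'[v' x  <-  p ;; '/' q ']'") : prog_scope.
Notation "$ a" := (Ret a) (at level 0, a at level 0, format "$ a") : prog_scope.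
Notation "p ^T" := (seq_tr p) : prog_scope.
Notation "p ^-1" := (seq_inv p) : prog_scope.
Notation "p + q" := (seq_add p q) : prog_scope.
Notation "p - q" := (seq_sub p q) : prog_scope.
Notation "p * q" := (seq_mul p q) : prog_scope.
Notation "1" := Id : prog_scope.
Notation "0" := Zero : prog_scope.

Section Scan.

Variables (V : nat -> nat -> Type) (E : Type) (op : E -> E -> prog V E).
Variable n : nat.

Definition ord_sub (i : 'I_n) (m : nat) : 'I_n :=
  Ordinal (leq_ltn_trans (leq_subr m i) (ltn_ord i)).

(* The nodes of level d + 1 of the binary tree are stored at the positions i
   with 2 ^ (d + 1) dividing i + 1. *)
Definition up_round (d : nat) (a : 'I_n -> E) : prog V ('I_n -> E) :=
  Par (fun i => if (2 ^ d.+1 %| i.+1)%N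
                then op (a (ord_sub i (2 ^ d))) (a i) else $(a i))%prog.

Definition down_round (d : nat) (a : 'I_n -> E) : prog V ('I_n -> E) :=
  Par (fun i => if (i.+1 %% 2 ^ d.+1 == 2 ^ d)%N && (2 ^ d < i.+1)%N
                then op (a (ord_sub i (2 ^ d))) (a i) else $(a i))%prog.

Fixpoint rounds (r : nat -> ('I_n -> E) -> prog V ('I_n -> E)) (ds : seq nat)
    (a : 'I_n -> E) : prog V ('I_n -> E) :=
  if ds is d :: ds' then Seq (r d a) (rounds r ds') else Ret a.

(* In-place inclusive scan; the length n need not be a power of 2. *)
Definition scan (a : 'I_n -> E) : prog V ('I_n -> E) :=
  Seq (rounds up_round (iota 0 (up_log 2 n)) a)
      (rounds down_round (rev (iota 0 (up_log 2 n)))).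

End Scan.

Definition fwd_scan V E (op : E -> E -> prog V E) n (a : 'I_n -> E) :=
  scan op a.

Definition bwd_scan V E (op : E -> E -> prog V E) n (a : 'I_n -> E) :=
  (s <- scan (fun x y => op y x) (fun i => a (rev_ord i)) ;;
   $(fun i => s (rev_ord i)))%prog.

(* Dynamics x_{k+1} = F_k x_k + c_k + L_k u_k from the initial state x_S = lq_x,
   stage costs (H_k x_k - r_k)^T X_k (H_k x_k - r_k) / 2 + u_k^T U_k u_k / 2 for
   S <= k < T, terminal cost (H_T x_T - r_T)^T X_T (H_T x_T - r_T) / 2. Values
   outside these ranges are irrelevant. *)
Record lqt (V : nat -> nat -> Type) (nx nu nr : nat) := Lqt {
  lq_F : nat -> V nx nx;
  lq_c : nat -> V nx 1%N;
  lq_L : nat -> V nx nu;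
  lq_H : nat -> V nr nx;
  lq_r : nat -> V nr 1%N;
  lq_X : nat -> V nr nr;
  lq_U : nat -> V nu nu;
  lq_x : V nx 1%N }.

Definition possemidef (R : realType) n (A : 'M[R]_n) : Prop :=
  A^T = A /\ forall x : 'cV[R]_n, 0 <= (x^T *m A *m x) 0 0.

Definition posdef (R : realType) n (A : 'M[R]_n) : Prop :=
  A^T = A /\ forall x : 'cV[R]_n, x != 0 -> 0 < (x^T *m A *m x) 0 0.

Definition lqt_wf (R : realType) nx nu nr (S T : nat)
    (D : lqt (matrix R) nx nu nr) : Prop :=
  (forall k, (S <= k <= T)%N -> possemidef (lq_X D k)) /\
  (forall k, (S <= k < T)%N -> posdef (lq_U D k)).

Record elem (V : nat -> nat -> Type) (nx : nat) := Elem {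
  el_A : V nx nx;
  el_b : V nx 1%N;
  el_C : V nx nx;
  el_eta : V nx 1%N;
  el_J : V nx nx }.

(* Values and gains; index i of an array stands for time S + i, with
   N = T - S. *)
Record value_law (V : nat -> nat -> Type) (nx nu N : nat) := ValueLaw {
  vl_S : 'I_N.+1 -> V nx nx;
  vl_v : 'I_N.+1 -> V nx 1%N;
  vl_K : 'I_N -> V nu nx;
  vl_Kv : 'I_N -> V nu nx;
  vl_Kc : 'I_N -> V nu nx }.

Section Algorithms.

Variables (V : nat -> nat -> Type) (nx nu nr : nat).

Local Open Scope prog_scope.

Definition otimes (x y : elem V nx) : prog V (elem V nx) :=
  let: Elem A1 b1 C1 eta1 J1 := x in
  let: Elem A2 b2 C2 eta2 J2 := y in
  P <- $A2 * (1 + $C1 * $J2)^-1 ;;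
  Q <- $A1^T * (1 + $J2 * $C1)^-1 ;;
  A <- $P * $A1 ;;
  b <- $P * ($b1 + $C1 * $eta2) + $b2 ;;
  C <- $P * $C1 * $A2^T + $C2 ;;
  eta <- $Q * ($eta2 - $J2 * $b1) + $eta1 ;;
  J <- $Q * $J2 * $A1 + $J1 ;;
  $(Elem A b C eta J).

Variables (S T : nat) (D : lqt V nx nu nr).

Definition stage_elem (k : nat) : prog V (elem V nx) :=
  C <- $(lq_L D k) * $(lq_U D k)^-1 * $(lq_L D k)^T ;;
  HX <- $(lq_H D k)^T * $(lq_X D k) ;;
  eta <- $HX * $(lq_r D k) ;;
  J <- $HX * $(lq_H D k) ;;
  $(Elem (lq_F D k) (lq_c D k) C eta J).

Definition terminal_elem : prog V (elem V nx) :=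
  A <- 0 ;;
  b <- 0 ;;
  C <- 0 ;;
  HX <- $(lq_H D T)^T * $(lq_X D T) ;;
  eta <- $HX * $(lq_r D T) ;;
  J <- $HX * $(lq_H D T) ;;
  $(Elem A b C eta J).

Definition gains (k : nat) (Sk1 : V nx nx) :
    prog V (V nu nx * V nu nx * V nu nx) :=
  LS <- $(lq_L D k)^T * $Sk1 ;;
  Mi <- ($LS * $(lq_L D k) + $(lq_U D k))^-1 ;;
  K <- $Mi * ($LS * $(lq_F D k)) ;;
  Kv <- $Mi * $(lq_L D k)^T ;;
  Kc <- $Mi * $LS ;;
  $(K, Kv, Kc).

Definition value_functions : prog V (value_law V nx nu (T - S)) :=
  a <- Par (fun i : 'I_(T - S).+1 =>
         if (S + i < T)%N then stage_elem (S + i) else terminal_elem) ;;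
  s <- bwd_scan otimes a ;;
  g <- Par (fun i : 'I_(T - S) => gains (S + i) (el_J (s (lift ord0 i)))) ;;
  $(ValueLaw (fun i => el_J (s i)) (fun i => el_eta (s i))
             (fun i => (g i).1.1) (fun i => (g i).1.2) (fun i => (g i).2)).

Variable vl : value_law V nx nu (T - S).

Definition cl_otimes (x y : V nx nx * V nx 1%N) :
    prog V (V nx nx * V nx 1%N) :=
  let: (F1, c1) := x in
  let: (F2, c2) := y in
  F <- $F2 * $F1 ;;
  c <- $F2 * $c1 + $c2 ;;
  $(F, c).

Definition cl_elem (i : 'I_(T - S)) : prog V (V nx nx * V nx 1%N) :=
  let k := (S + i)%N in
  F <- $(lq_F D k) - $(lq_L D k) * $(vl_K vl i) ;;
  c <- $(lq_c D k)
       + $(lq_L D k) * $(vl_Kv vl i) * $(vl_v vl (lift ord0 i))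
       - $(lq_L D k) * $(vl_Kc vl i) * $(lq_c D k) ;;
  if i == 0%N :> nat then
    Z <- 0 ;;
    x <- $F * $(lq_x D) + $c ;;
    $(Z, x)
  else $(F, c).

(* Both methods return x_{S+1}, ..., x_T, the state x_{S+i+1} at index i. *)
Definition method1 : prog V ('I_(T - S) -> V nx 1%N) :=
  a <- Par cl_elem ;;
  s <- fwd_scan cl_otimes a ;;
  $(fun i => (s i).2).

Definition method2 : prog V ('I_(T - S) -> V nx 1%N) :=
  a <- Par (fun i : 'I_(T - S) => stage_elem (S + i)) ;;
  s <- fwd_scan otimes a ;;
  Par (fun i : 'I_(T - S) =>
    let: Elem A b C _ _ := s i in
    (1 + $C * $(vl_S vl (lift ord0 i)))^-1
    * ($A * $(lq_x D) + $b + $C * $(vl_v vl (lift ord0 i)))).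

End Algorithms.

(* Main.v *)
(* Every element initialisation, operator application and gain computation is a
   bounded number of instructions on matrices whose dimensions are positive and
   at most a multiple of n_x, so its span is at most a constant times the cost B
   of the dearest instruction; the scans contribute O(log T) rounds. With
   inversions B is O(n_x) (a product costs O(log n_x), which is also O(n_x));
   Method 1 inverts nothing, so there B is O(log n_x). *)
Require Import Defs.
From mathcomp Require Import all_boot all_order all_algebra.
From mathcomp Require Import reals exp.
From mathcomp Require Import zify ring lra.

Set Implicit Arguments.
Unset Strict Implicit.
Unset Printing Implicit Defensive.

Import Order.TTheory GRing.Theory Num.Theory.
Local Open Scope ring_scope.

(** * Span bounds over the natural numbers, relative to a per-instruction budget *)

Section NatBounds.
Local Open Scope nat_scope.

(** Products and inversions get separate widths: products involve [lq_H], whose row count [nr] may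
    exceed [nx], while only matrices of size [nx] and [nu <= nx] are inverted. *)
Definition mul_bounded (M : routines) (w B : nat) : Prop :=
  forall m n p, 0 < m <= w -> 0 < n <= w -> 0 < p <= w ->
    mul_steps M m n p <= B.

Definition inv_bounded (M : routines) (w B : nat) : Prop :=
  forall n, 0 < n <= w -> inv_steps M n <= B.

Lemma span_par_le (R : realType) (M : routines) n A
    (f : 'I_n -> prog (matrix R) A) B :
  (forall i, span_time M (f i) <= B) -> span_time M (Par f) <= B.
Proof. by move=> fB /=; apply/bigmax_leqP => i _. Qed.

(** Asking for [B2] at every [x], not just at [result p], keeps all the bounds independent of the
    data. *)
Lemma span_seq_le (R : realType) (M : routines) A1 A2
    (p : prog (matrix R) A1) (f : A1 -> prog (matrix R) A2) B1 B2 :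
  span_time M p <= B1 -> (forall x, span_time M (f x) <= B2) ->
  span_time M (Seq p f) <= B1 + B2.
Proof. by move=> pB fB; apply: leq_add. Qed.

Lemma span_rounds_le (R : realType) (M : routines) E n
    (r : nat -> ('I_n -> E) -> prog (matrix R) ('I_n -> E)) B :
  (forall d a, span_time M (r d a) <= B) ->
  forall ds a, span_time M (rounds r ds a) <= size ds * B.
Proof.
move=> rB; elim=> [|d ds IH] a //=.
by rewrite mulSn leq_add.
Qed.

(** Each sweep has [up_log 2 n] rounds, and in a round every position runs at most one [op], all in
    parallel; the doubling accounts for the two sweeps. *)
Lemma span_scan_le (R : realType) (M : routines) E
    (op : E -> E -> prog (matrix R) E) B n (a : 'I_n -> E) :
  (forall x y, span_time M (op x y) <= B) ->
  span_time M (scan op a) <= (up_log 2 n * B).*2.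
Proof.
move=> opB; rewrite -addnn leq_add //.
- apply: leq_trans (span_rounds_le _ _ _) _; last by rewrite size_iota.
  by move=> d b; apply: span_par_le => i; case: ifP.
- apply: leq_trans (span_rounds_le _ _ _) _; last by rewrite size_rev size_iota.
  by move=> d b; apply: span_par_le => i; case: ifP.
Qed.

(** Every routine cost is replaced by an unknown number at most [B], which leaves a linear goal.
    Programs without inversions pass [Hmul] in both slots. *)
Ltac bound_steps Hmul Hinv :=
  repeat match goal with
  | |- context [mul_steps ?M ?m ?n ?p] =>
      have /(_ ltac:(lia) ltac:(lia) ltac:(lia)) := Hmul m n p;
      generalize (mul_steps M m n p); intros ? ?
  | |- context [inv_steps ?M ?n] =>
      have /(_ ltac:(lia)) := Hinv n;
      generalize (inv_steps M n); intros ? ?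
  end; lia.

(** 27 is the number of instructions issued by [otimes], run one after the other; entrywise ones
    cost [1 <= B]. The constants of the next lemmas are instruction counts too. *)
Lemma span_otimes_le (R : realType) (M : routines) w B nx
    (x y : elem (matrix R) nx) :
  mul_bounded M w B -> inv_bounded M nx B -> 0 < B -> 0 < nx <= w ->
  span_time M (otimes x y) <= 27 * B.
Proof.
case: x y => [A1 b1 C1 e1 J1] [A2 b2 C2 e2 J2] Hmul Hinv B0 nxw /=.
bound_steps Hmul Hinv.
Qed.

Lemma span_stage_elem_le (R : realType) (M : routines) w B nx nu nr
    (D : lqt (matrix R) nx nu nr) k :
  mul_bounded M w B -> inv_bounded M nx B -> 0 < B -> 0 < nu <= nx ->
  nx <= w -> 0 < nr <= w -> span_time M (stage_elem D k) <= 8 * B.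
Proof. move=> Hmul Hinv B0 nunx nxw nrw /=; bound_steps Hmul Hinv. Qed.

Lemma span_terminal_elem_le (R : realType) (M : routines) w B nx nu nr
    T (D : lqt (matrix R) nx nu nr) :
  mul_bounded M w B -> 0 < B -> 0 < nx <= w -> 0 < nr <= w ->
  span_time M (terminal_elem T D) <= 7 * B.
Proof. move=> Hmul B0 nxw nrw /=; bound_steps Hmul Hmul. Qed.

Lemma span_gains_le (R : realType) (M : routines) w B nx nu nr
    (D : lqt (matrix R) nx nu nr) k (Sk1 : 'M[R]_nx) :
  mul_bounded M w B -> inv_bounded M nx B -> 0 < B -> 0 < nu <= nx ->
  nx <= w -> span_time M (gains D k Sk1) <= 10 * B.
Proof. move=> Hmul Hinv B0 nunx nxw /=; bound_steps Hmul Hinv. Qed.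

Lemma span_cl_otimes_le (R : realType) (M : routines) B nx
    (x y : 'M[R]_nx * 'cV[R]_nx) :
  mul_bounded M nx B -> 0 < B -> 0 < nx ->
  span_time M (cl_otimes x y) <= 3 * B.
Proof. case: x y => [F1 c1] [F2 c2] Hmul B0 nx0 /=; bound_steps Hmul Hmul. Qed.

Lemma span_cl_elem_le (R : realType) (M : routines) B nx nu nr S T
    (D : lqt (matrix R) nx nu nr) (vl : value_law (matrix R) nx nu (T - S)) i :
  mul_bounded M nx B -> 0 < B -> 0 < nu <= nx ->
  span_time M (cl_elem D vl i) <= 11 * B.
Proof.
by move=> Hmul B0 nunx /=; case: ifP => _ /=; bound_steps Hmul Hmul.
Qed.

(** * Spans of the three algorithms *)

Lemma span_value_functions_le (R : realType) (M : routines) w B nx nu nr S T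
    (D : lqt (matrix R) nx nu nr) :
  mul_bounded M w B -> inv_bounded M nx B -> 0 < B -> 0 < nu <= nx ->
  nx <= w -> 0 < nr <= w -> S < T ->
  span_time M (value_functions S T D) <= 72 * (up_log 2 (T - S).+1 * B).
Proof.
move=> Hmul Hinv B0 nunx nxw nrw ST.
have nx0 : 0 < nx <= w by lia.
(* As [T - S + 1 >= 2], the logarithm is at least 1, so initialisation and gains are absorbed: 8 + 2
   * 27 + 10 = 72. *)
have k0 : B <= up_log 2 (T - S).+1 * B.
  by apply: leq_pmull; rewrite up_log_gt0; lia.
apply: (@leq_trans (8 * B + ((up_log 2 (T - S).+1 * (27 * B)).*2 + 10 * B))).
  apply: span_seq_le => [|a]; last apply: span_seq_le => [|s].
  - apply: span_par_le => i; case: ifP => _.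
      exact: (span_stage_elem_le _ _ Hmul).
    by apply: leq_trans (span_terminal_elem_le _ _ Hmul _ _ _) _ => //; lia.
  - rewrite /= addn0; apply: span_scan_le => x y.
    exact: span_otimes_le Hmul Hinv B0 nx0.
  - rewrite -[10 * B]addn0; apply: span_seq_le => //; apply: span_par_le => i.
    exact: (span_gains_le _ _ _ Hmul).
by lia.
Qed.

Lemma span_method1_le (R : realType) (M : routines) B nx nu nr S T
    (D : lqt (matrix R) nx nu nr) (vl : value_law (matrix R) nx nu (T - S)) :
  mul_bounded M nx B -> 0 < B -> 0 < nu <= nx -> S < T ->
  span_time M (method1 D vl) <= 17 * (up_log 2 (T - S).+1 * B).
Proof.
move=> Hmul B0 nunx ST.
have k0 : B <= up_log 2 (T - S).+1 * B.
  by apply: leq_pmull; rewrite up_log_gt0; lia.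
(* The scan has only [T - S] elements, and [up_log 2 1 = 0]; passing to the successor leaves a
   positive factor to absorb the initialisation. *)
have kB : up_log 2 (T - S) * B <= up_log 2 (T - S).+1 * B.
  by rewrite leq_mul2r leq_up_log ?orbT.
apply: (@leq_trans (11 * B + (up_log 2 (T - S) * (3 * B)).*2)); last by lia.
apply: span_seq_le => [|a].
- by apply: span_par_le => i; apply: span_cl_elem_le.
- rewrite /= addn0; apply: span_scan_le => x y.
  by apply: span_cl_otimes_le => //; lia.
Qed.

Lemma span_method2_le (R : realType) (M : routines) w B nx nu nr S T
    (D : lqt (matrix R) nx nu nr) (vl : value_law (matrix R) nx nu (T - S)) :
  mul_bounded M w B -> inv_bounded M nx B -> 0 < B -> 0 < nu <= nx ->
  nx <= w -> 0 < nr <= w -> S < T ->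
  span_time M (method2 D vl) <= 71 * (up_log 2 (T - S).+1 * B).
Proof.
move=> Hmul Hinv B0 nunx nxw nrw ST.
have nx0 : 0 < nx <= w by lia.
have k0 : B <= up_log 2 (T - S).+1 * B.
  by apply: leq_pmull; rewrite up_log_gt0; lia.
have kB : up_log 2 (T - S) * B <= up_log 2 (T - S).+1 * B.
  by rewrite leq_mul2r leq_up_log ?orbT.
apply: (@leq_trans (8 * B + ((up_log 2 (T - S) * (27 * B)).*2 + 9 * B)));
  last by lia.
apply: span_seq_le => [|a]; last apply: span_seq_le => [|s].
- by apply: span_par_le => i; apply: (span_stage_elem_le _ _ Hmul).
- by apply: span_scan_le => x y; apply: span_otimes_le Hmul Hinv B0 nx0.
- apply: span_par_le => i; case: (s i) => A b C _ _ /=.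
  bound_steps Hmul Hinv.
Qed.

End NatBounds.

(** * Passage to real bounds with [log1] *)

Lemma log1_ge1 (R : realType) n : 1 <= log1 R n.
Proof. by rewrite /log1 le_max lexx. Qed.

Lemma log1_homo (R : realType) m n : (m <= n)%N -> log1 R m <= log1 R n.
Proof.
case: m => [|m] mn; first by rewrite /log1 ln0 // max_l // log1_ge1.
rewrite /log1 ge_max !le_max lexx /= ler_ln ?posrE ?ltr0n ?(leq_trans _ mn) //.
by rewrite ler_nat mn orbT.
Qed.

Lemma log1_le_nat (R : realType) n : (0 < n)%N -> log1 R n <= n%:R.
Proof.
move=> n0; rewrite /log1 ge_max ler1n n0 /=.
by apply/ltW/ln_sublinear; rewrite ltr0n.
Qed.

(** Minimality of [k] gives [2 ^ (k - 1) <= n], and [ln 2 >= 1/2], so [k <= 2 ln n + 1]; both terms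
    are controlled by [log1], whence the 3. *)
Lemma up_log_succ_le_log1 (R : realType) n :
  (0 < n)%N -> (up_log 2 n.+1)%:R <= 3 * log1 R n.
Proof.
move=> n0; set k := up_log 2 n.+1.
have k0 : (0 < k)%N by rewrite up_log_gt0.
have pk : (2 ^ k.-1 <= n)%N.
  by have /andP[] := @up_log_bounds 2 n.+1 isT (leq_ltn_trans n0 (ltnSn n)).
(* This is [ln (1 + x) <= x] at [x = -1/2]. *)
have h2 : 2^-1 <= ln (2 : R).
  have := @le_ln1Dx R (- 2^-1).
  have -> : 1 + - 2^-1 = 2^-1 :> R by lra.
  by rewrite lnV ?posrE // => H; have := H ltac:(lra); lra.
have kn : k.-1%:R * ln 2 <= ln n%:R :> R.
  rewrite mulr_natl -lnXn // -natrX ler_ln ?posrE ?ltr0n ?expn_gt0 //.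
  by rewrite ler_nat.
have l1 := log1_ge1 R n.
have ll : ln n%:R <= log1 R n by rewrite /log1 le_max lexx orbT.
have := ler_wpM2l (ler0n R k.-1) h2.
have -> : k%:R = k.-1%:R + 1 :> R by rewrite natr1 prednK.
lra.
Qed.

Lemma mul_bounded_log1 (R : realType) M (c : R) :
  0 <= c ->
  (forall m n p, (0 < m)%N -> (0 < n)%N -> (0 < p)%N ->
    (mul_steps M m n p)%:R <= c * log1 R (maxn m (maxn n p))) ->
  forall w B, c * log1 R w <= B%:R -> mul_bounded M w B.
Proof.
move=> c0 mulc w B wB m n p /andP[m0 mw] /andP[n0 nw] /andP[p0 pw].
rewrite -(ler_nat R); apply: le_trans (mulc _ _ _ m0 n0 p0) (le_trans _ wB).
by rewrite ler_wpM2l // log1_homo // !geq_max mw nw.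
Qed.

(** Supplies a positive integer budget [B] for a real cost bound; rounding up adds at most 1, which
    [y >= 1] absorbs into the constant. *)
Lemma exists_nat_bound (R : realType) (x y : R) :
  0 <= x -> 1 <= y -> exists B : nat, [/\ (0 < B)%N, x * y <= B%:R
    & B%:R <= (x + 1) * y].
Proof.
move=> x0 y1; exists (Num.truncn (x * y)).+1; split=> //.
  by rewrite ltW // truncnS_gt.
rewrite -natr1 mulrDl lerD ?mul1r // truncn_le.
by rewrite mulr_ge0 // (le_trans _ y1).
Qed.

Lemma span_le_log1 (R : realType) (d : R) a N B n y :
  (n <= a * (up_log 2 N.+1 * B))%N -> (0 < N)%N -> B%:R <= d * y ->
  n%:R <= 3 * a%:R * d * (y * log1 R N).
Proof.
move=> na N0 By.
apply: (@le_trans _ _ (a%:R * ((up_log 2 N.+1)%:R * B%:R))).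
  by rewrite -!natrM ler_nat.
have := ler_pM (ler0n _ _) (ler0n _ _) (up_log_succ_le_log1 R N0) By.
move/(ler_wpM2l (ler0n R a)) => /le_trans; apply.
by rewrite le_eqVlt; apply/orP; left; apply/eqP; ring.
Qed.

(** * One constant for the three complexity bounds *)

Theorem lemma17 (R : realType) (M : routines)
    (mul_log : exists c : R, forall m n p : nat,
      (0 < m)%N -> (0 < n)%N -> (0 < p)%N ->
      (mul_steps M m n p)%:R <= c * log1 R (maxn m (maxn n p)))
    (inv_lin : exists c : R, forall n : nat,
      (0 < n)%N -> (inv_steps M n)%:R <= c * n%:R)
    (kappa : nat) :
  exists c : R, forall (nx nu nr S T : nat) (D : lqt (matrix R) nx nu nr),
    (0 < nu)%N -> (nu <= nx)%N ->
    (0 < nr)%N -> (nr <= kappa * nx)%N ->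
    (S < T)%N -> lqt_wf S T D ->
    let vl := result (value_functions S T D) in
    [/\ (span_time M (value_functions S T D))%:R
          <= c * (nu%:R + nx%:R * log1 R (T - S)),
        (span_time M (method1 D vl))%:R
          <= c * (log1 R nu + log1 R (T - S) * log1 R nx)
      & (span_time M (method2 D vl))%:R
          <= c * (nx%:R + nx%:R * log1 R (T - S))].
Proof.
have [c mulc] := mul_log; have [e inve] := inv_lin.
(* Step counts are nonnegative, so evaluating the hypotheses at size 1 fixes the signs of [c] and
   [e]. *)
have c0 : 0 <= c.
  have := le_trans (ler0n _ _) (mulc 1 1 1 isT isT isT).
  by rewrite pmulr_lge0 // (lt_le_trans ltr01) ?log1_ge1.
have e0 : 0 <= e.
  by have := le_trans (ler0n _ _) (inve 1 isT); rewrite mulr1.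
(* [d * nx] dominates both routines: a product of width [(kappa + 1) * nx] by [log1 w <= w], an
   inversion by [e * nx]. *)
pose d : R := c * kappa.+1%:R + e.
have d0 : 0 <= d by rewrite addr_ge0 // mulr_ge0.
have d1 : 0 <= d + 1 by lra.
have cd : c <= d.
  rewrite /d -natr1; have := mulr_ge0 c0 (ler0n R kappa); lra.
(* 3 compares [up_log] with [log1], 72 is the largest instruction count, and [d + 1] is the rounded
   cost per instruction. *)
exists (3 * 72 * (d + 1)) => nx nu nr S T D nu0 nunx nr0 nrnx ST _ vl.
have nx0 : (0 < nx)%N by lia.
have N0 : (0 < T - S)%N by rewrite subn_gt0.
have nunx' : (0 < nu <= nx)%N by rewrite nu0.
have nxR : 1 <= nx%:R :> R by rewrite ler1n.
have lT := log1_ge1 R (T - S).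
have lx := log1_ge1 R nx.
have lu := log1_ge1 R nu.
pose w := (kappa.+1 * nx)%N.
have nxw : (nx <= w)%N by rewrite /w; lia.
have nrw : (0 < nr <= w)%N by rewrite /w; lia.
have [B [B0 dB Bd]] := exists_nat_bound d0 nxR.
have mulB : mul_bounded M w B.
  apply: (mul_bounded_log1 c0 mulc); apply: le_trans dB.
  apply: (@le_trans _ _ (c * w%:R)).
    by rewrite ler_wpM2l // log1_le_nat // (leq_trans nx0).
  by rewrite natrM mulrA ler_wpM2r // lerDl.
have invB : inv_bounded M nx B.
  move=> n /andP[n0 nnx]; rewrite -(ler_nat R).
  apply: le_trans (inve n n0) (le_trans _ dB).
  by rewrite ler_pM ?ler_nat // lerDr mulr_ge0.
(* Method 1 multiplies only matrices of dimensions at most [nx] and inverts none, so its budget is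
   logarithmic. *)
have [B' [B'0 cB' B'c]] := exists_nat_bound c0 lx.
have mulB' := mul_bounded_log1 c0 mulc cB'.
have B'd : B'%:R <= (d + 1) * log1 R nx.
  by apply: le_trans B'c _; rewrite ler_wpM2r ?lerD2r // (le_trans _ lx).
(* Here [s] is the term with [log1 R (T - S)], which already bounds the whole span, and [t] is the
   other summand of the stated bound. *)
have weaken (a : nat) (s t : R) : (a <= 72)%N -> 0 <= s -> 0 <= t ->
    3 * a%:R * (d + 1) * s <= 3 * 72 * (d + 1) * (t + s).
  move=> a72 s0 t0; apply: ler_pM; rewrite ?lerDr //.
    by apply: mulr_ge0 => //; apply: mulr_ge0.
  by rewrite ler_wpM2r // ler_wpM2l // (ler_nat R a 72).
have nxlT : 0 <= nx%:R * log1 R (T - S) by rewrite mulr_ge0 // (le_trans _ lT).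
split.
- apply: le_trans (weaken 72%N _ nu%:R isT nxlT (ler0n _ _)).
  apply: span_le_log1 N0 Bd.
  exact: (span_value_functions_le _ mulB invB).
- have lxT : 0 <= log1 R nx * log1 R (T - S).
    by rewrite mulr_ge0 // ?(le_trans _ lT) ?(le_trans _ lx).
  rewrite [_ * log1 R nx]mulrC.
  apply: le_trans (weaken 17%N _ (log1 R nu) isT lxT (le_trans ler01 lu)).
  apply: span_le_log1 N0 B'd.
  exact: span_method1_le.
- apply: le_trans (weaken 71%N _ nx%:R isT nxlT (ler0n _ _)).
  apply: span_le_log1 N0 Bd.
  exact: (span_method2_le _ _ mulB invB).
Qed.
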